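(* There exist absolute constants $c_1,c_2,\epsilon>0$ such that for every sufficiently large $n$ there exists a monotone, non-negative, $\frac{c_1}{n}$-Lipschitz submodular function $f\colon\mathbb F_2^n\to[0,1]$ (namely a rescaling of a matroid rank function) with $R^{lin}_{\epsilon\text{-approx}}(f)\ge c_2n$.
   Context: Functions $f\colon 2^{[n]}\to\mathbb R$ are identified with functions on $\mathbb F_2^n$ via $x\leftrightarrow\{i:x_i=1\}$. $f$ is monotone if $f(A)\le f(B)$ for $A\subseteq B$; $\alpha$-Lipschitz if $|f(S\cup\{i\})-f(S)|\le\alpha$ for all $S\subseteq[n]$, $i\in[n]$; submodular if $f(A\cup\{i\})-f(A)\ge f(B\cup\{i\})-f(B)$ for all $A\subseteq B\subseteq[n]$ and $i\notin B$. For $S\subseteq[n]$, $\chi_S(x)=\sum_{i\in S}x_i\pmod2$. Approximate randomized $\mathbb F_2$-sketch complexity: $R^{lin}_{\epsilon\text{-approx}}(f)$ is the smallest integer $k$ such that there exist a probability distribution over $k$-tuples of subsets $\mathbf S_1,\dots,\mathbf S_k\subseteq[n]$ and $g\colon\mathbb F_2^k\to\mathbb R$ with $\mathbb E_{\mathbf S_1,\dots,\mathbf S_k}[(g(\chi_{\mathbf S_1}(x),\dots,\chi_{\mathbf S_k}(x))-f(x))^2]\le\epsilon$ for every $x\in\mathbb F_2^n$. *)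

(* Defs.v *)
From HB Require Import structures.
From mathcomp Require Import all_boot all_order all_algebra.
Set Implicit Arguments. Unset Strict Implicit. Unset Printing Implicit Defensive.
Import Order.TTheory GRing.Theory Num.Theory.
Local Open Scope ring_scope.

(* x in F_2^n is identified with the set {i : x_i = 1} : {set 'I_n}. *)

(* chi_S(x) = sum_{i in S} x_i mod 2 *)
Definition chi (n : nat) (S x : {set 'I_n}) : bool := odd #|S :&: x|.

Definition monotone_fn (R : realFieldType) (n : nat) (f : {set 'I_n} -> R) : Prop :=
  forall A B : {set 'I_n}, A \subset B -> f A <= f B.

Definition lipschitz_fn (R : realFieldType) (n : nat) (alpha : R)
  (f : {set 'I_n} -> R) : Prop :=
  forall (S : {set 'I_n}) (i : 'I_n), `|f (i |: S) - f S| <= alpha.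

Definition submodular_fn (R : realFieldType) (n : nat) (f : {set 'I_n} -> R) : Prop :=
  forall (A B : {set 'I_n}) (i : 'I_n), A \subset B -> i \notin B ->
    f (i |: B) - f B <= f (i |: A) - f A.

Definition matroid_rank (n : nat) (r : {set 'I_n} -> nat) : Prop :=
  [/\ forall X : {set 'I_n}, (r X <= #|X|)%N,
      forall X Y : {set 'I_n}, X \subset Y -> (r X <= r Y)%N
    & forall X Y : {set 'I_n}, (r (X :|: Y) + r (X :&: Y) <= r X + r Y)%N].

(* A k-tuple of subsets is an element of {ffun 'I_k -> {set 'I_n}}; a
   probability distribution over them is a nonnegative weight function
   summing to 1 (the space is finite). The sketch g maps F_2^k -> R. *)
Definition sketch_achieves (R : realFieldType) (n k : nat) (f : {set 'I_n} -> R)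
  (eps : R) : Prop :=
  exists (p : {ffun 'I_k -> {set 'I_n}} -> R) (g : {ffun 'I_k -> bool} -> R),
    [/\ forall S, 0 <= p S,
        \sum_S p S = 1
      & forall x : {set 'I_n},
          \sum_S p S * (g [ffun i => chi (S i) x] - f x) ^+ 2 <= eps].

(* R^lin_{eps-approx}(f) >= r : every k admitting an eps-approximate
   randomized F_2-sketch satisfies r <= k (i.e. the smallest such k is >= r). *)
Definition Rlin_approx_ge (R : realFieldType) (n : nat) (f : {set 'I_n} -> R)
  (eps r : R) : Prop :=
  forall k : nat, sketch_achieves k f eps -> r <= k%:R.

(* Main.v *)
(* A matroid with exponentially many prescribed flats is hard to sketch. Take
   sets A_i of size 4u = Theta(n), 2 ^ (4u) many, with pairwise intersections of
   size at most 2u: the graphs of the words of a Gilbert-Varshamov code over a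
   16-letter alphabet. For every subfamily B, the function

     r(X) = min(|X|, 4u, min_{i in B} (3u + |X \ A_i|))

   is a matroid rank function with r(A_i) = 3u for i in B and r(A_i) = 4u
   otherwise. Averaging a sketch of f = r / 4u over its randomness and over the
   A_i fixes the tuple of parities, and rounding then produces a boolean
   function of k bits that agrees with B on 15/16 of the indices. There are at
   most 2 ^ (nk + 2 ^ k) such functions, so for k <= u a counting argument gives
   a B that is far from all of them. *)

Require Import Defs.
From HB Require Import structures.
From mathcomp Require Import all_boot all_order all_algebra.
From mathcomp Require Import zify lra.
Import Order.TTheory GRing.Theory Num.Theory.
Local Open Scope ring_scope.

Set Implicit Arguments.
Unset Strict Implicit.
Unset Printing Implicit Defensive.

Lemma leq_exp2rW (m n e : nat) : (m <= n -> m ^ e <= n ^ e)%N.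
Proof. by case: e => // e le_mn; rewrite leq_exp2r. Qed.

(** * Agreement of words: moment bound, union bound and codes *)

Section Agreement.
Local Open Scope nat_scope.

Definition agree (I Q : finType) (f g : {ffun I -> Q}) : nat :=
  #|[set i | f i == g i]|.

Lemma agreeC (I Q : finType) (f g : {ffun I -> Q}) : agree f g = agree g f.
Proof. by apply: eq_card => i; rewrite !inE eq_sym. Qed.

(* Exponential moment bound: [z ^ agree f g] factors over the coordinates. *)
Lemma card_agree_ge (I Q : finType) (f : {ffun I -> Q}) (s z : nat) :
  0 < z ->
  #|[set g | s <= agree f g]| * z ^ s <= (#|Q|.-1 + z) ^ #|I|.
Proof.
move=> z_gt0.
have momentE (g : {ffun I -> Q}) :
    z ^ agree f g = \prod_i (if f i == g i then z else 1).
  rewrite -big_mkcond prod_nat_const /=; congr (z ^ _).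
  by apply: eq_card => i; rewrite !inE.
have -> : (#|Q|.-1 + z) ^ #|I| = \sum_(g : {ffun I -> Q}) z ^ agree f g.
  rewrite (eq_bigr _ (fun g _ => momentE g)).
  rewrite -(bigA_distr_bigA (fun i q => if f i == q then z else 1)).
  rewrite -prod_nat_const; apply: eq_bigr => i _.
  rewrite (bigD1 (f i)) //= eqxx addnC; congr (_ + _).
  rewrite (eq_bigr (fun=> 1)); last by move=> q /negbTE; rewrite eq_sym => ->.
  rewrite sum1_card -[in LHS](cardC1 (f i)).
  by apply: eq_card => q; rewrite !inE.
rewrite -sum_nat_const [X in _ <= X](bigID (mem [set g | s <= agree f g])) /=.
apply: leq_trans (leq_addr _ _); apply: leq_sum => g.
by rewrite inE => le_s; rewrite leq_pexp2l.
Qed.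

(** Union bound: by [card_agree_ge] each [F p] rules out at most [(#|Q|.-1 + z) ^ #|I| / z ^ s]
    words, too few in total to exhaust all [#|Q| ^ #|I|]. *)
Lemma exists_far (I Q P : finType) (F : P -> {ffun I -> Q}) (s z : nat) :
  0 < z -> #|P| * (#|Q|.-1 + z) ^ #|I| < #|Q| ^ #|I| * z ^ s ->
  exists g, forall p, agree (F p) g < s.
Proof.
move=> z_gt0 lt_count.
have [/existsP[g /forallP g_far]|/existsPn no_far] :=
    boolP [exists g, forall p, agree (F p) g < s].
  by exists g.
suff: #|Q| ^ #|I| * z ^ s <= #|P| * (#|Q|.-1 + z) ^ #|I|.
  by rewrite leqNgt lt_count.
have cover : [set: {ffun I -> Q}] \subset
    \bigcup_p [set g | s <= agree (F p) g].
  apply/subsetP => g _; have /forallPn[p] := no_far g.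
  by rewrite -leqNgt => le_s; apply/bigcupP; exists p; rewrite ?inE.
have /leq_trans := subset_leq_card cover.
rewrite cardsT card_ffun => le_card.
have /le_card le_sum : #|\bigcup_p [set g | s <= agree (F p) g]| <=
    \sum_p #|[set g | s <= agree (F p) g]|.
  elim/big_rec2: _ => [|p n A _ IH]; first by rewrite cards0.
  by rewrite cardsU; apply: leq_trans (leq_subr _ _) _; rewrite leq_add2l.
apply: leq_trans (leq_mul le_sum (leqnn _)) _.
rewrite big_distrl /= -sum_nat_const.
by apply: leq_sum => p _; apply: card_agree_ge.
Qed.

(* Gilbert's greedy construction. *)
Lemma exists_code (I Q : finType) (m s z : nat) :
  0 < z -> m * (#|Q|.-1 + z) ^ #|I| <= #|Q| ^ #|I| * z ^ s ->
  exists w : 'I_m -> {ffun I -> Q},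
    forall i j, i != j -> agree (w i) (w j) < s.
Proof.
move=> z_gt0 le_count.
have [l [size_l code_l]] : exists l : seq {ffun I -> Q},
    size l = m /\ pairwise (fun g h => agree g h < s) l.
  elim: m le_count => [|m IH] le_count; first by exists [::].
  have pos : 0 < (#|Q|.-1 + z) ^ #|I| by rewrite expn_gt0 addn_gt0 z_gt0 orbT.
  have lt_count : m * (#|Q|.-1 + z) ^ #|I| < #|Q| ^ #|I| * z ^ s.
    by apply: leq_trans le_count; rewrite ltn_pmul2r.
  have [l [size_l code_l]] := IH (ltnW lt_count).
  have [|g g_far] := @exists_far I Q 'I_(size l) (tnth (in_tuple l)) s z z_gt0.
    by rewrite card_ord size_l.
  exists (g :: l); rewrite /= size_l code_l andbT; split=> //.
  apply/allP => h /(@tnthP _ _ (in_tuple l))[i ->].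
  by rewrite agreeC g_far.
pose w := tnth (Tuple (introT eqP size_l)); exists w => i j.
have lt_l (i' : 'I_m) : (i' : nat) \in gtn (size l) by rewrite inE size_l.
move/(pairwiseP (w i)): code_l => code_l; rewrite /w !(tnth_nth (w i)) /=.
case: (ltngtP i j) => [lt_ij _|lt_ji _|/val_inj-> /eqP//].
  exact: code_l.
by rewrite agreeC; apply: code_l.
Qed.

End Agreement.

(** * The matroid rank function with prescribed flats *)

Section Rank.
Local Open Scope nat_scope.

Variables (n d b : nat) (I : finType) (A : I -> {set 'I_n}) (B : pred I).

Definition flats_rank (X : {set 'I_n}) : nat :=
  \big[minn/minn #|X| d]_(i | B i) (b + #|X :\: A i|).

Lemma flats_rank_le_card X : flats_rank X <= #|X|.
Proof.
rewrite /flats_rank; elim/big_rec: _ => [|i r _ le_r]; first exact: geq_minl.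
exact: leq_trans (geq_minr _ _) le_r.
Qed.

Lemma flats_rank_le X : flats_rank X <= d.
Proof.
rewrite /flats_rank; elim/big_rec: _ => [|i r _ le_r]; first exact: geq_minr.
exact: leq_trans (geq_minr _ _) le_r.
Qed.

Lemma flats_rank_le_flat X i : B i -> flats_rank X <= b + #|X :\: A i|.
Proof.
move=> Bi; rewrite /flats_rank.
have : i \in index_enum I by rewrite mem_index_enum.
elim: (index_enum I) => // j s IH; rewrite inE big_cons.
case/predU1P => [<-|/IH le_i]; first by rewrite Bi geq_minl.
by case: ifP => // _; apply: leq_trans (geq_minr _ _) le_i.
Qed.

Variant flats_rank_spec (X : {set 'I_n}) : nat -> Prop :=
  | FlatsRankCard : flats_rank_spec X #|X|
  | FlatsRankTop : flats_rank_spec X d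
  | FlatsRankFlat i of B i : flats_rank_spec X (b + #|X :\: A i|).

Lemma flats_rankP X : flats_rank_spec X (flats_rank X).
Proof.
rewrite /flats_rank; elim/big_rec: _ => [|i r Bi spec_r].
  by case: (leqP #|X| d) => _; constructor.
by case: (leqP (b + #|X :\: A i|) r) => _ //; constructor.
Qed.

Hypothesis small_cap :
  forall i j, i != j -> #|A i :&: A j| + d <= 2 * b.

(** For submodularity, split on which terms attain the minima at [X] and [Y], and bound the ranks of
    the union and the intersection by suitable terms. Only two distinct flats require
    [small_cap]. *)
Lemma flats_matroid_rank : matroid_rank flats_rank.
Proof.
(* Serves the case where one rank is a cardinality and the other comes from the flat [C]. *)
have split_le (X Y C : {set 'I_n}) :
    #|(X :|: Y) :\: C| + #|X :&: Y| <= #|X| + #|Y :\: C|.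
  rewrite setDUl -(cardsID Y X).
  have : #|X :\: C :|: Y :\: C| <= #|X :\: Y| + #|Y :\: C|.
    rewrite -cardsUI; apply: leq_trans (leq_addr _ _).
    apply: subset_leq_card; apply/subsetP => x; rewrite !inE.
    by case: (x \in C); case: (x \in X); case: (x \in Y).
  lia.
split=> [X|X Y sXY|X Y]; first exact: flats_rank_le_card.
  case: (flats_rankP Y) => [||i Bi].
  - exact: leq_trans (flats_rank_le_card X) (subset_leq_card sXY).
  - exact: flats_rank_le.
  - apply: leq_trans (flats_rank_le_flat X Bi) _.
    by rewrite leq_add2l subset_leq_card // setSD.
have capX : X :&: Y \subset X by apply: subsetIl.
have capY : X :&: Y \subset Y by apply: subsetIr.
have leX := subset_leq_card capX; have leY := subset_leq_card capY.
have cap_card := flats_rank_le_card (X :&: Y).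
have cap_top := flats_rank_le (X :&: Y).
have cup_card := flats_rank_le_card (X :|: Y).
have cup_top := flats_rank_le (X :|: Y).
have cardUI := cardsUI X Y.
case: (flats_rankP X) => [||i Bi]; case: (flats_rankP Y) => [||j Bj]; try lia.
- have := flats_rank_le_flat (X :|: Y) Bj; have := split_le X Y (A j); lia.
- have := flats_rank_le_flat (X :&: Y) Bj.
  have := subset_leq_card (setSD (A j) capY); lia.
- have := flats_rank_le_flat (X :|: Y) Bi; have := split_le Y X (A i).
  rewrite setUC setIC; lia.
- have := flats_rank_le_flat (X :&: Y) Bi.
  have := subset_leq_card (setSD (A i) capX); lia.
have [eq_ij|neq_ij] := eqVneq i j.
  have := flats_rank_le_flat (X :|: Y) Bj.
  have := flats_rank_le_flat (X :&: Y) Bj.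
  have := cardsUI (X :\: A j) (Y :\: A j); rewrite -setDUl -setDIl eq_ij; lia.
(* For distinct flats, the union has rank at most [d] and the intersection at most [#|X :&: Y|];
   this cover and [small_cap] bound the sum by [2 * b + #|X :\: A i| + #|Y :\: A j|]. *)
have capU : X :&: Y \subset (X :\: A i) :|: (Y :\: A j) :|: (A i :&: A j).
  apply/subsetP => x; rewrite !inE.
  by case: (x \in A i); case: (x \in A j); case: (x \in X); case: (x \in Y).
have := subset_leq_card capU; have := small_cap neq_ij.
have := cardsUI (X :\: A i :|: Y :\: A j) (A i :&: A j).
have := cardsUI (X :\: A i) (Y :\: A j); lia.
Qed.

Lemma flats_rank_in i : B i -> b <= d -> #|A i| = d -> flats_rank (A i) = b.
Proof.
move=> Bi le_bd cardA; apply/eqP; rewrite eqn_leq; apply/andP; split.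
  by have := flats_rank_le_flat (A i) Bi; rewrite setDv cards0 addn0.
by case: (flats_rankP (A i)) => [||j _]; rewrite ?cardA // leq_addr.
Qed.

(** Each [j] in [B] differs from [i], so [#|A i :\: A j| >= 2 * (d - b)] and the term of [j] is at
    least [2 * d - b >= d]. *)
Lemma flats_rank_notin i :
  ~~ B i -> b <= d -> #|A i| = d -> flats_rank (A i) = d.
Proof.
move=> nBi le_bd cardA; apply/eqP; rewrite eqn_leq flats_rank_le /=.
case: (flats_rankP (A i)) => [||j Bj]; rewrite ?cardA //.
have /small_cap : i != j by apply: contraNneq nBi => ->.
have := cardsID (A j) (A i); rewrite cardA; lia.
Qed.

End Rank.

(** * Analytic properties of scaled rank functions *)

Section RankScaling.
Variables (R : realFieldType) (n : nat) (r : {set 'I_n} -> nat) (c : R).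
Hypotheses (r_matroid : matroid_rank r) (c_ge0 : 0 <= c).

Lemma matroid_rank_setU1 (S : {set 'I_n}) i : (r (i |: S) <= r S + 1)%N.
Proof.
case: r_matroid => r_card _ r_sub.
apply: leq_trans (leq_addr _ _) (leq_trans (r_sub [set i] S) _).
by rewrite addnC leq_add2l -(cards1 i) r_card.
Qed.

Lemma scaled_rank_monotone : monotone_fn (fun S => c * (r S)%:R).
Proof.
case: r_matroid => _ r_mono _ X Y sXY.
by rewrite ler_wpM2l // ler_nat r_mono.
Qed.

Lemma scaled_rank_lipschitz : lipschitz_fn c (fun S => c * (r S)%:R).
Proof.
move=> S i; case: r_matroid => _ r_mono _.
have le_r := r_mono _ _ (subsetUr [set i] S).
rewrite -mulrBr -natrB // normrM ger0_norm // normr_nat.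
rewrite -[leRHS]mulr1 ler_wpM2l // lern1.
by have := matroid_rank_setU1 S i; rewrite leq_subLR.
Qed.

Lemma scaled_rank_submodular : submodular_fn (fun S => c * (r S)%:R).
Proof.
move=> X Y i sXY niY; case: r_matroid => _ _ r_sub.
(* The union of these two sets is [i |: Y] and their intersection is [X]. *)
have := r_sub (i |: X) Y.
rewrite -setUA (setUidPr sXY) setIUl (setIidPl sXY).
have -> : [set i] :&: Y = set0.
  by apply/setP => j; rewrite !inE; case: eqP => // ->; apply: negbTE.
rewrite set0U -(ler_nat R) !natrD => le_r.
by rewrite -!mulrBr ler_wpM2l //; lra.
Qed.

End RankScaling.

(** * Counting sketches *)

Definition sketch (n k : nat) (S : {ffun 'I_k -> {set 'I_n}}) (x : {set 'I_n}) :
  {ffun 'I_k -> bool} := [ffun i => chi (S i) x].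

(** Padding with empty sets places sketches of every size up to [K] in a single finite type, ready
    for counting. *)
Lemma sketch_widen (n k K : nat) (h : {ffun 'I_k -> bool} -> bool)
    (S : {ffun 'I_k -> {set 'I_n}}) :
  (k <= K)%N ->
  exists (S' : {ffun 'I_K -> {set 'I_n}})
         (h' : {ffun {ffun 'I_K -> bool} -> bool}),
    forall x, h' (sketch S' x) = h (sketch S x).
Proof.
move=> le_kK.
exists [ffun i : 'I_K => if insub (val i) is Some j then S j else set0].
exists [ffun v : {ffun 'I_K -> bool} => h [ffun i => v (widen_ord le_kK i)]].
move=> x; rewrite ffunE; congr h; apply/ffunP => i; rewrite !ffunE /=.
by rewrite valK.
Qed.

Lemma exists_hard_labelling (n K M : nat) (A : 'I_(16 * M) -> {set 'I_n}) :
  (n * K + 2 ^ K < 5 * M)%N ->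
  exists B : {ffun 'I_(16 * M) -> bool},
    forall k (S : {ffun 'I_k -> {set 'I_n}}) h, (k <= K)%N ->
      (agree [ffun i => h (sketch S (A i))] B < 15 * M)%N.
Proof.
move=> lt_M.
pose P : finType := ({ffun 'I_K -> {set 'I_n}} *
  {ffun {ffun 'I_K -> bool} -> bool})%type.
(* With [z = 8], [9 ^ 2 <= 2 ^ 7] gives [9 ^ (16 * M) <= 2 ^ (56 * M)], against [2 ^ (16 * M) * 8 ^
   (15 * M) = 2 ^ (61 * M)]: this leaves [5 * M] bits for the pairs in [P]. *)
have [//||B B_far] := @exists_far _ _ P
    (fun p => [ffun i => p.2 (sketch p.1 (A i))]) (15 * M) 8.
  rewrite card_prod !card_ffun -(cardsT {set _}) -powersetT card_powerset cardsT.
  rewrite !card_ord card_bool -expnM -expnD.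
  have -> : (2.-1 + 8 = 9)%N by [].
  have -> : (16 * M = 2 * (8 * M))%N by lia.
  rewrite (expnM 9).
  apply: (@leq_ltn_trans (2 ^ (n * K + 2 ^ K) * (2 ^ 7) ^ (8 * M))).
    by rewrite leq_mul2l leq_exp2rW ?orbT.
  have -> : (8 ^ (15 * M) = 2 ^ (3 * (15 * M)))%N by rewrite (expnM 2 3).
  rewrite -expnM -!expnD ltn_exp2l //; lia.
exists B => k S h /(sketch_widen h S)[S' [h' eq_h]].
have := B_far (S', h'); congr (agree _ _ < _)%N.
by apply/ffunP => i; rewrite !ffunE eq_h.
Qed.

(** * Set families from codes *)

Definition graph_set (n : nat) (I Q : finType) (e : I * Q -> 'I_n)
  (f : {ffun I -> Q}) : {set 'I_n} := [set e (i, f i) | i : I].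

Lemma card_graph_setI (n : nat) (I Q : finType) (e : I * Q -> 'I_n) f g :
  injective e -> #|graph_set e f :&: graph_set e g| = agree f g.
Proof.
move=> e_inj; pose G := [set e (i, f i) | i in [set i | f i == g i]].
have -> : graph_set e f :&: graph_set e g = G.
  apply/setP => x; rewrite inE; apply/andP/imsetP => [[]|[i]].
    case/imsetP => i _ -> /imsetP[j _ /e_inj[<- eq_fg]].
    by exists i; rewrite // inE eq_fg.
  rewrite inE => /eqP eq_fg ->; split; first exact: imset_f.
  by rewrite eq_fg; apply: imset_f.
by rewrite card_imset // => i j /e_inj[].
Qed.

Lemma card_graph_set (n : nat) (I Q : finType) (e : I * Q -> 'I_n) f :
  injective e -> #|graph_set e f| = #|I|.
Proof. by move=> e_inj; rewrite card_imset // => i j /e_inj[]. Qed.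

Lemma exists_small_cap_family (n u m : nat) :
  (64 * u <= n)%N -> (m <= 2 ^ (4 * u))%N ->
  exists A : 'I_m -> {set 'I_n},
    (forall i, #|A i| = (4 * u)%N) /\
    (forall i j, i != j -> (#|A i :&: A j| <= 2 * u)%N).
Proof.
move=> le_n le_m.
(* With [z = 16] the base is [15 + 16 <= 2 ^ 5], and both sides of the count are then bounded
   through [2 ^ (24 * u)]. *)
have [//||w w_code] := @exists_code 'I_(4 * u) 'I_16 m (2 * u) 16.
  rewrite !card_ord /=; apply: (@leq_trans (2 ^ (4 * u) * (2 ^ 5) ^ (4 * u))).
    by rewrite leq_mul // leq_exp2rW.
  by rewrite -[16%N]/(2 ^ 4)%N -!expnM -!expnD leq_exp2l //; lia.
have le_card : (#|{: 'I_(4 * u) * 'I_16}| <= n)%N.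
  by rewrite card_prod !card_ord; lia.
pose e x := widen_ord le_card (enum_rank x).
have e_inj : injective e by move=> x y [/ord_inj/enum_rank_inj].
exists (fun i => graph_set e (w i)); split=> [i|i j /w_code lt_agree].
  by rewrite card_graph_set // card_ord.
by rewrite card_graph_setI // ltnW.
Qed.

(** * Rounding a sketch, and the choice of parameters *)

(* Rounding [g] at the threshold [7/8] gives a boolean function of the sketch;
   each disagreement with [B] costs a squared error of at least [1/64]. *)
Lemma sketch_error_lower_bound (R : realFieldType) (n k M : nat)
    (f : {set 'I_n} -> R) (A : 'I_(16 * M) -> {set 'I_n})
    (B : {ffun 'I_(16 * M) -> bool}) :
  (forall i, f (A i) = if B i then 3 / 4 else 1) ->
  (forall (S : {ffun 'I_k -> {set 'I_n}}) h,
     (agree [ffun i => h (sketch S (A i))] B < 15 * M)%N) ->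
  ~ sketch_achieves k f (1 / 1024).
Proof.
move=> fA B_hard [p [g [p_ge0 p_sum p_err]]].
pose h v : bool := g v < 7 / 8.
have errS S : (M.+1)%:R / 64 <= \sum_i (g (sketch S (A i)) - f (A i)) ^+ 2.
  pose D := [set i | h (sketch S (A i)) != B i].
  have leD : (M < #|D|)%N.
    have := B_hard S h; rewrite /agree.
    have -> : [set i | [ffun i => h (sketch S (A i))] i == B i] = ~: D.
      by apply/setP => i; rewrite !inE ffunE negbK.
    by have := cardsC D; rewrite card_ord; lia.
  apply: (@le_trans _ _ (\sum_(i in D) (1 / 64 : R))).
    rewrite sumr_const -[leRHS]mulr_natr mulrC mul1r ler_wpM2l ?ler_nat //.
    by rewrite invr_ge0 ler0n.
  rewrite [leRHS](bigID (mem D)) /= -[leLHS]addr0.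
  apply: lerD; last by apply: sumr_ge0 => i _; apply: sqr_ge0.
  apply: ler_sum => i; rewrite inE fA /h.
  set y := g _; case: (B i); case: (ltP y (7 / 8)) => // ? _; nra.
(* Over [16 * M] indices the allowed error totals [16 * M / 1024 = M / 64], less than the
   [(M + 1) / 64] forced by every tuple [S]. *)
have: \sum_i \sum_S p S * (g (sketch S (A i)) - f (A i)) ^+ 2 <= M%:R / 64.
  apply: le_trans (ler_sum _ (fun i _ => p_err (A i))) _.
  by rewrite sumr_const card_ord -[leLHS]mulr_natr natrM; lra.
rewrite exchange_big /=; apply/negP; rewrite -ltNge.
apply: (@lt_le_trans _ _ ((M.+1)%:R / 64)); first by rewrite -[M.+1%:R]natr1; lra.
rewrite -[leLHS]mul1r -[X in X * _ <= _]p_sum mulr_suml; apply: ler_sum => S _.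
by rewrite -mulr_sumr ler_wpM2l //; apply: errS.
Qed.

(** The counting condition of [exists_hard_labelling] for [K = u], [n <= 128 * u] and
    [M = 2 ^ (4 * u - 4)]. *)
Lemma quadratic_lt_exp (u : nat) : (5 <= u)%N ->
  (128 * u * u + 2 ^ u < 5 * 2 ^ (4 * u - 4))%N.
Proof.
move=> le5u; have lt_u : (u <= 2 ^ u)%N by apply: ltnW (ltn_expl _ _).
have : (128 * u * u <= 2 ^ (4 * u - 3))%N.
  apply: (@leq_trans (2 ^ 7 * 2 ^ u * 2 ^ u)); first by rewrite !leq_mul.
  by rewrite -!expnD leq_exp2l //; lia.
have : (2 ^ u <= 2 ^ (4 * u - 4))%N by rewrite leq_exp2l //; lia.
have -> : (4 * u - 3 = (4 * u - 4).+1)%N by lia.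
have : (0 < 2 ^ (4 * u - 4))%N by rewrite expn_gt0.
rewrite expnS; lia.
Qed.

Theorem mainTheorem11 (R : realFieldType) :
  exists (c1 c2 eps : R), [/\ 0 < c1, 0 < c2 & 0 < eps] /\
  exists N : nat, forall n : nat, (N <= n)%N ->
    exists f : {set 'I_n} -> R,
      [/\ monotone_fn f /\ (forall S, 0 <= f S /\ f S <= 1),
          lipschitz_fn (c1 / n%:R) f,
          submodular_fn f,
          (exists (c : R) (r : {set 'I_n} -> nat),
              0 < c /\ matroid_rank r /\ forall S, f S = c * (r S)%:R)
        & Rlin_approx_ge f eps (c2 * n%:R)].
Proof.
(* Since [n <= 128 * u], the Lipschitz constant [1 / (4 * u)] is at most [128 / n], and [k >= u]
   gives [k >= n / 128]. *)
exists 128, (1 / 128), (1 / 1024); split; first by split; lra.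
(* [320 = 64 * 5] ensures [u >= 5]; [M] is chosen so that the family has [16 * M = 2 ^ (4 * u)]
   members. *)
exists 320%N => n le_n; pose u := (n %/ 64)%N; pose M := (2 ^ (4 * u - 4))%N.
have [le_u le_un le_nu] : [/\ 5 <= u, 64 * u <= n & n <= 128 * u]%N.
  by rewrite /u; split; lia.
have [//||A [cardA capA]] := @exists_small_cap_family n u (16 * M).
  by rewrite -[16%N]/(2 ^ 4)%N -expnD leq_exp2l //; lia.
have [|B B_hard] := @exists_hard_labelling n u M A.
  by apply: leq_ltn_trans (quadratic_lt_exp le_u); rewrite leq_add2r leq_mul.
pose r := flats_rank (4 * u) (3 * u) A B.
have smallA i j : i != j -> (#|A i :&: A j| + 4 * u <= 2 * (3 * u))%N.
  by move/capA; lia.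
have r_matroid : matroid_rank r by apply: flats_matroid_rank.
pose c : R := (4 * u)%:R^-1.
have u_gt0 : 0 < (4 * u)%:R :> R by rewrite ltr0n; lia.
have n_gt0 : 0 < n%:R :> R by rewrite ltr0n; lia.
have c_gt0 : 0 < c by rewrite invr_gt0.
have c_ge0 := ltW c_gt0.
have le_34 : (3 * u <= 4 * u)%N by rewrite leq_mul2r orbT.
have le_nuR : n%:R <= 128 * u%:R :> R by rewrite -natrM ler_nat.
exists (fun S => c * (r S)%:R); split.
- split=> [|S]; first exact: scaled_rank_monotone.
  split; first by rewrite mulr_ge0.
  by rewrite mulrC ler_pdivrMr // mul1r ler_nat flats_rank_le.
- move=> S i; apply: le_trans (scaled_rank_lipschitz r_matroid c_ge0 S i) _.
  rewrite ler_pdivlMr // mulrC ler_pdivrMr // natrM; nra.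
- exact: scaled_rank_submodular.
- by exists c, r.
- move=> k sketch_k; suff le_uk : (u <= k)%N.
    by have : u%:R <= k%:R :> R by [rewrite ler_nat]; lra.
  rewrite leqNgt; apply/negP => /ltnW le_ku.
  apply: (sketch_error_lower_bound _ _ sketch_k) => [i|S h]; last exact: B_hard.
  case: ifP => [Bi|/negbT nBi].
    rewrite /r flats_rank_in //; apply: (canLR (mulKf (lt0r_neq0 u_gt0))).
    by rewrite !natrM; lra.
  by rewrite /r flats_rank_notin // /c mulVf // gt_eqF.
Qed.
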